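(* Let $n\ge2$. If $\mathcal{L}$ is an $LD$-pencil in $\mathcal{H}_n$ (i.e. contained in $\mathcal{H}_n$) with canonical basis $\{P,P'\}$, then the restriction $\Delta|_{\mathcal{L}}$ of the span function is convex and has a global minimum at $P$. In particular, for any $P\in\mathcal{H}_n$ and $\lambda\in\mathbb{R}$ one has $\Delta(P)\le\Delta(P-\lambda P')$. More generally, for any $P\in\mathcal{H}_n$, if $\lambda_1,\lambda_2\in\mathbb{R}$ are such that $\lambda_1\lambda_2\ge0$ and $|\lambda_1|\le|\lambda_2|$, then $\Delta(P-\lambda_1P')\le\Delta(P-\lambda_2P')$.
   Context: $\mathcal{R}_n$ is the set of monic real polynomials of degree $n$ and $\mathcal{H}_n\subset\mathcal{R}_n$ the subset of those with only real zeros. For $P\in\mathcal{H}_n$ the span $\Delta(P)$ is the difference between its largest and smallest zero. A polynomial pencil in $\mathcal{R}_n$ is a real line $\mathcal{L}=\{(1-\lambda)P_1+\lambda P_2\mid\lambda\in\mathbb{R}\}$ through two distinct $P_1,P_2\in\mathcal{R}_n$. A basis of $\mathcal{L}$ is a pair of real polynomials $\{P,Q\}$ with $P\in\mathcal{R}_n$, $\deg Q\le n-1$, leading coefficient of $Q$ equal to $n$, and $\mathcal{L}=\{P-\lambda Q\mid\lambda\in\mathbb{R}\}$. $\mathcal{L}$ is an $LD$-pencil if there exist $Q_1,Q_2,Q_3\in\mathcal{L}$ with $Q_3'=Q_1-Q_2$; equivalently, it has a (necessarily unique) basis of the form $\{P,P'\}$, called its canonical basis. (For $P\in\mathcal{H}_n$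 and $\lambda\in\mathbb{R}$, the polynomial $P-\lambda P'$ is again in $\mathcal{H}_n$.) *)

(* Defs.v *)
From mathcomp Require Import all_boot all_order all_algebra.
From mathcomp Require Import polyrcf complex.
From mathcomp Require Import classical_sets reals convex.
Set Implicit Arguments.
Unset Strict Implicit.
Unset Printing Implicit Defensive.
Import Order.TTheory GRing.Theory Num.Theory.
Local Open Scope classical_set_scope.
Local Open Scope ring_scope.

Definition monic_polys (R : realType) (n : nat) : set {poly R} :=
  [set p | p \is monic /\ size p = n.+1].

(* [Zeros] are the complex ones: a polynomial in this set is one all of whose
   zeros in R[i] lie on the real axis. *)
Definition real_rooted_polys (R : realType) (n : nat) : set {poly R} :=
  [set p | monic_polys n p /\
    forall z : R[i], root (map_poly (real_complex R) p) z -> complex.Im z = 0].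

(* [rootsR p] is the strictly increasing list of the real zeros of [p]; it is
   nonempty for [p] in [real_rooted_polys n] with 0 < n. *)
Definition largest_zero (R : realType) (p : {poly R}) : R := last 0 (rootsR p).
Definition smallest_zero (R : realType) (p : {poly R}) : R := head 0 (rootsR p).
Definition zero_span (R : realType) (p : {poly R}) : R :=
  largest_zero p - smallest_zero p.

Lemma mem_rootsR (R : realType) (p : {poly R}) (x : R) :
  p != 0 -> (x \in rootsR p) = root p x.
Proof. by move=> p0; rewrite -(roots_on_rootsR p0) in_itv. Qed.

Lemma largest_zeroP (R : realType) (p : {poly R}) (x : R) :
  p != 0 -> root p x -> root p (largest_zero p) /\ x <= largest_zero p.
Proof.
move=> p0; rewrite -!(mem_rootsR _ p0) /largest_zero.
have := sorted_roots (- cauchy_bound p) (cauchy_bound p) p.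
rewrite -/(rootsR p) lt_sorted_pairwise; elim/last_ind: (rootsR p) => // s y _.
rewrite last_rcons mem_rcons in_cons pairwise_rcons => /andP[sy _].
rewrite mem_rcons in_cons eqxx.
by case/predU1P=> [->|xs]; split=> //; apply/ltW/(allP sy).
Qed.

Lemma smallest_zeroP (R : realType) (p : {poly R}) (x : R) :
  p != 0 -> root p x -> root p (smallest_zero p) /\ smallest_zero p <= x.
Proof.
move=> p0; rewrite -!(mem_rootsR _ p0) /smallest_zero.
have := sorted_roots (- cauchy_bound p) (cauchy_bound p) p.
rewrite -/(rootsR p) lt_sorted_pairwise; case: (rootsR p) => //= y s.
case/andP=> sy _; rewrite !in_cons eqxx.
by case/predU1P=> [->|xs]; split=> //; apply/ltW/(allP sy).
Qed.

Definition pencil (R : realType) (n : nat) (L : set {poly R}) : Prop :=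
  exists P1 P2 : {poly R}, [/\ monic_polys n P1, monic_polys n P2, P1 <> P2 &
    L = [set (1 - l) *: P1 + l *: P2 | l in [set: R]]].

Definition pencil_basis (R : realType) (n : nat) (L : set {poly R})
    (P Q : {poly R}) : Prop :=
  [/\ monic_polys n P, (size Q <= n)%N, lead_coef Q = n%:R &
      L = [set P - l *: Q | l in [set: R]]].

Definition LD_pencil (R : realType) (n : nat) (L : set {poly R}) : Prop :=
  pencil n L /\
  exists Q1 Q2 Q3 : {poly R}, [/\ L Q1, L Q2, L Q3 & Q3^`() = Q1 - Q2].

Definition canonical_basis (R : realType) (n : nat) (L : set {poly R})
    (P : {poly R}) : Prop := pencil_basis n L P P^`().

(* Main.v *)
(** With a_1, ..., a_n the zeros of P, the polynomial P - l P' is the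
    characteristic polynomial of the real symmetric matrix diag(a) + l J, where
    J is the all-ones matrix.  Its largest zero is thus the maximum over unit
    vectors v of the form [quad_form a l v], which is affine in l; hence the
    largest zero is convex in l and, likewise, the smallest zero is concave.
    Evaluating the form at basis vectors gives
    smallest <= a_i + l <= largest for all i, so the span is minimal at l = 0.
    Monotonicity on each side of 0 follows from convexity. *)
Require Import Defs.
From mathcomp Require Import all_boot all_order all_algebra.
From mathcomp Require Import polyrcf complex.
From mathcomp Require Import classical_sets reals convex.
From mathcomp Require Import interval_inference ring lra.
Import Order.TTheory GRing.Theory Num.Theory.
Local Open Scope classical_set_scope.
Local Open Scope ring_scope.

(** * Products of linear factors and the pencil in terms of the zeros *)

(** Uniqueness of the indices ensures that [j != i] deletes exactly one factor. *)
Lemma deriv_prod_uniq (F : comNzRingType) (I : eqType) (s : seq I)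
    (f : I -> {poly F}) :
  uniq s ->
  (\prod_(i <- s) f i)^`() =
  \sum_(i <- s) (f i)^`() * \prod_(j <- s | j != i) f j.
Proof.
elim: s => [|k s IH] /=; first by rewrite !big_nil -polyC1 derivC.
case/andP=> ks us; rewrite !big_cons derivM (IH us) eqxx /=; congr (_ + _).
  congr (_ * _); rewrite [LHS]big_seq [RHS]big_seq_cond.
  apply: eq_bigl => j; case: (boolP (j \in s)) => // js.
  by apply/esym; apply: contraNneq ks => <-.
rewrite big_distrr big_seq [RHS]big_seq; apply: eq_bigr => i si /=.
rewrite big_cons; case: eqP => [ki|_]; first by rewrite ki si in ks.
by rewrite mulrCA.
Qed.

(** An indexed family keeps multiplicities and serves directly as the diagonal of diag(a). *)
Definition poly_of_zeros {F : comNzRingType} {n : nat} (a : 'I_n -> F) :=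
  \prod_i ('X - (a i)%:P).

Definition pencil_of_zeros {F : comNzRingType} {n : nat} (a : 'I_n -> F)
    (l : F) := poly_of_zeros a - l *: (poly_of_zeros a)^`().

Lemma horner_poly_of_zeros {F : comNzRingType} {n : nat} (a : 'I_n -> F) y :
  (poly_of_zeros a).[y] = \prod_i (y - a i).
Proof.
rewrite /poly_of_zeros (big_morph _ (id1 := 1) (op1 := *%R)
  (fun p q => hornerM p q y) (hornerC 1 y)).
by apply: eq_bigr => i _; rewrite hornerXsubC.
Qed.

Lemma horner_deriv_poly_of_zeros {F : comNzRingType} {n : nat}
    (a : 'I_n -> F) y :
  (poly_of_zeros a)^`().[y] = \sum_i \prod_(j | j != i) (y - a j).
Proof.
rewrite /poly_of_zeros deriv_prod_uniq ?index_enum_uniq // horner_sum.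
apply: eq_bigr => i _; rewrite derivXsubC mul1r.
rewrite (big_morph _ (id1 := 1) (op1 := *%R)
  (fun p q => hornerM p q y) (hornerC 1 y)).
by apply: eq_bigr => j _; rewrite hornerXsubC.
Qed.

Lemma horner_pencil_of_zeros {F : comNzRingType} {n : nat} (a : 'I_n -> F) l y :
  (pencil_of_zeros a l).[y] =
  \prod_i (y - a i) - l * \sum_i \prod_(j | j != i) (y - a j).
Proof.
by rewrite hornerD hornerN hornerZ horner_poly_of_zeros
  horner_deriv_poly_of_zeros.
Qed.

Lemma pencil_of_zeros0 {F : comNzRingType} {n : nat} (a : 'I_n -> F) :
  pencil_of_zeros a 0 = poly_of_zeros a.
Proof. by rewrite /pencil_of_zeros scale0r subr0. Qed.

Lemma zero_of_pencil0 {F : idomainType} {n : nat} (a : 'I_n -> F) y :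
  root (pencil_of_zeros a 0) y -> exists i, y = a i.
Proof.
rewrite rootE horner_pencil_of_zeros mul0r subr0 prodf_seq_eq0 => /hasP[i _ /=].
by rewrite subr_eq0 => /eqP; exists i.
Qed.

(** * Zeros of the pencil as eigenvalues *)

(* The vector v is an eigenvector of diag(a) + l J for the eigenvalue y. *)
Definition eigenvector {F : comNzRingType} {n : nat} (a : 'I_n -> F)
    (l y : F) (v : 'I_n -> F) :=
  (exists i, v i != 0) /\ forall i, (y - a i) * v i = l * \sum_j v j.

(** Weighting the i-th eigenvector equation by the product of the other factors and summing gives
    P(y) S = l P'(y) S, where S is the coordinate sum of v. If S = 0, then y equals two of the [a i]
    with distinct indices, so P and P' both vanish at y. *)
Lemma root_of_eigenvector {F : fieldType} {n : nat} (a : 'I_n -> F) l y v :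
  eigenvector a l y v -> root (pencil_of_zeros a l) y.
Proof.
case=> -[i vi0] Hv; rewrite rootE horner_pencil_of_zeros.
have [S0|S0] := eqVneq (\sum_j v j) 0; last first.
  rewrite subr_eq0; apply/eqP/(mulIf S0).
  rewrite mulrAC [RHS]mulrC big_distrl big_distrr /=.
  by apply: eq_bigr => j _; rewrite -(Hv j) (bigD1 j) //= mulrA [X in X * _]mulrC.
have ya j : v j != 0 -> y = a j.
  move=> vj; apply/eqP; rewrite -subr_eq0.
  by have /eqP := Hv j; rewrite S0 mulr0 mulf_eq0 (negPf vj) orbF.
(* A zero coordinate sum forces a second nonzero coordinate. *)
have [j /andP[ji vj]] : exists j, (j != i) && (v j != 0).
  apply/existsP; apply: contraNT vi0; rewrite negb_exists => /forallP H.
  rewrite -S0 (bigD1 i) //= big1 ?addr0 // => j ji.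
  by have := H j; rewrite ji /= negbK => /eqP.
rewrite (bigD1 i) //= (ya _ vi0) subrr mul0r sub0r oppr_eq0.
rewrite big1 ?mulr0 // => k _; have [->|ik] := eqVneq k i.
  by rewrite (bigD1 j) //= -(ya _ vi0) (ya _ vj) subrr mul0r.
by rewrite (bigD1 i) 1?eq_sym //= subrr mul0r.
Qed.

(* The vector with entries [\prod_(j | j != i) (y - a j)] works unless it is
   zero, in which case y = a i = a j for some i != j and e_i - e_j works. *)
Lemma eigenvector_of_root {F : fieldType} {n : nat} (a : 'I_n -> F) l y :
  root (pencil_of_zeros a l) y -> exists v, eigenvector a l y v.
Proof.
rewrite rootE horner_pencil_of_zeros subr_eq0 => /eqP H.
pose w i := \prod_(j | j != i) (y - a j).
have Hw i : (y - a i) * w i = l * \sum_j w j by rewrite -H [RHS](bigD1 i).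
have [/existsP[i wi]|] := boolP [exists i, w i != 0].
  by exists w; split=> //; exists i.
rewrite negb_exists => /forallP w0.
have {}w0 i : w i = 0 by apply/eqP; have := w0 i; rewrite negbK.
have /eqP : \prod_i (y - a i) = 0
  by rewrite H (eq_bigr (fun=> 0)) ?big1_eq ?mulr0 // => k _; exact: w0.
rewrite prodf_seq_eq0 => /hasP[i _ /= yi].
have /eqP := w0 i; rewrite prodf_seq_eq0 => /hasP[j _ /andP[ji yj]].
exists (fun k => (k == i)%:R - (k == j)%:R); split.
  by exists i; rewrite eqxx (eq_sym i) (negPf ji) subr0 oner_eq0.
move=> k; rewrite sumrB (bigD1 i) //= eqxx big1 => [|m /negPf->//].
rewrite (bigD1 j) //= eqxx big1 => [|m /negPf->//].
rewrite subrr mulr0.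
have [->|ki] := eqVneq k i; first by rewrite (eqP yi) mul0r.
have [->|kj] := eqVneq k j; first by rewrite (eqP yj) mul0r.
by rewrite subrr mulr0.
Qed.

(** * The quadratic form and its spectral decomposition *)

(** This is v^T (diag(a) + l J) v, because v^T J v is the square of the coordinate sum. *)
Definition quad_form {F : comNzRingType} {n : nat} (a : 'I_n -> F) (l : F)
    (v : 'I_n -> F) :=
  \sum_i a i * v i ^+ 2 + l * (\sum_i v i) ^+ 2.

Lemma quad_form_eigenvector {F : comNzRingType} {n : nat} (a : 'I_n -> F)
    l y v :
  eigenvector a l y v -> quad_form a l v = y * \sum_i v i ^+ 2.
Proof.
case=> _ Hv; rewrite /quad_form expr2 mulrA [X in _ + X]big_distrr.
rewrite -big_split mulr_sumr /=.
by apply: eq_bigr => i _; rewrite -(Hv i); ring.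
Qed.

Lemma quad_form_delta {F : comNzRingType} {n : nat} (a : 'I_n -> F) l i :
  quad_form a l (fun j => (j == i)%:R) = a i + l.
Proof.
rewrite /quad_form (bigD1 i) //= big1 => [|j /negPf->]; last first.
  by rewrite expr0n mulr0.
rewrite (bigD1 i) //= big1 => [|j /negPf->//].
by rewrite eqxx !addr0 expr1n !mulr1.
Qed.

Lemma quad_form_conv {F : comNzRingType} {n : nat} (a : 'I_n -> F) t l1 l2 v :
  quad_form a (t * l1 + (1 - t) * l2) v =
  t * quad_form a l1 v + (1 - t) * quad_form a l2 v.
Proof. rewrite /quad_form; ring. Qed.

Lemma sum_sqr_gt0 {R : realDomainType} {n : nat} (v : 'I_n -> R) i :
  v i != 0 -> 0 < \sum_i v i ^+ 2.
Proof.
move=> vi; rewrite (bigD1 i) //= ltr_wpDr ?sumr_ge0 // => [j _|].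
  exact: sqr_ge0.
by rewrite exprn_even_gt0.
Qed.

(** Lets the spectral theorem be applied over [R[i]] and its eigenvalues be read as zeros over
    [R]. *)
Lemma map_pencil_of_zeros {F K : fieldType} (f : {rmorphism F -> K}) {n : nat}
    (a : 'I_n -> F) l :
  map_poly f (pencil_of_zeros a l) = pencil_of_zeros (f \o a) (f l).
Proof.
rewrite /pencil_of_zeros rmorphB /= map_polyZ -deriv_map.
suff -> : map_poly f (poly_of_zeros a) = poly_of_zeros (f \o a) by [].
by rewrite rmorph_prod; apply: eq_bigr => i _; rewrite /= map_polyXsubC.
Qed.

(* [d] is the spectrum of diag(a) + l J and [q] the squared moduli of the
   coordinates of v in an orthonormal eigenbasis. *)
Lemma spectral_quad_form {R : rcfType} {n : nat} (a : 'I_n -> R) (l : R)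
    (v : 'I_n -> R) :
  exists d q : 'I_n -> R,
    [/\ forall i, root (pencil_of_zeros a l) (d i), forall i, 0 <= q i,
        \sum_i v i ^+ 2 = \sum_i q i
      & quad_form a l v = \sum_i d i * q i].
Proof.
pose c : {rmorphism R -> R[i]} := real_complex R.
pose A : 'M[R[i]]_n := \matrix_(i, j) c (a i *+ (i == j) + l).
have Aherm : A \is hermsymmx.
  apply: realsym_hermsym.
    apply/is_hermitianmxP; rewrite expr0 scale1r map_mx_id //.
    by apply/matrixP => i j; rewrite !mxE eq_sym; case: eqP => [->|].
  by apply/mxOverP => i j; rewrite mxE complex_real.
have /mxOverP Dreal := hermitian_spectral_diag_real Aherm.
have /orthomx_spectralP := hermitian_normalmx Aherm.
set U := spectralmx A; set D := spectral_diag A => AE.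
have Uunit : U \is unitarymx := spectral_unitarymx A.
pose d i := complex.Re (D 0 i).
have dE i : c (d i) = D 0 i.
  by have /complex_realP[k] := Dreal 0 i; rewrite /d => ->.
pose u : 'rV[R[i]]_n := \row_i c (v i).
(* Coordinates of [u] along the orthonormal rows of [U]. *)
pose x := u *m (U ^t*)%sesqui.
pose q i := complex.Re (x 0 i * (x 0 i)^*).
have qE i : c (q i) = x 0 i * (x 0 i)^*.
  have /ger0_real/complex_realP[k] : 0 <= x 0 i * (x 0 i)^*.
    exact: mul_conjC_ge0.
  by rewrite /q => ->.
have xt : (x ^t*)%sesqui = U *m u^T.
  rewrite /x trmx_mul map_mxM map_trmx trmxK -map_mx_comp.
  rewrite (map_mx_id (@conjCK _)); congr (_ *m _).
  apply/matrixP => i j; rewrite !mxE; apply/CrealP.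
  by rewrite complex_real.
(* Used twice: [e] = 1 yields the squared norm of v, and [e] = [D] yields the quadratic form. *)
have form_diag (e : 'rV_n) :
    (u *m (invmx U *m diag_mx e *m U) *m u^T) 0 0 =
    \sum_i e 0 i * (x 0 i * (x 0 i)^*).
  rewrite invmx_unitary // -!mulmxA -xt !mulmxA -/x mxE.
  apply: eq_bigr => i _; rewrite mul_mx_diag !mxE; ring.
exists d, q; split.
(* Row i of [U] is an eigenvector for [D 0 i], nonzero because rows of a unitary matrix have norm
   one. *)
- move=> i; rewrite -(fmorph_root c) map_pencil_of_zeros dE.
  apply: (root_of_eigenvector _ _ _ (fun j => U i j)); split.
    apply/existsP; apply: contraT; rewrite negb_exists => /forallP U0.
    have /unitarymxP/matrixP/(_ i i)/eqP := Uunit.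
    rewrite !mxE eqxx big1 => [|j _]; first by rewrite eq_sym oner_eq0.
    by have /negPn/eqP -> := U0 j; rewrite mul0r.
  move=> j; have /matrixP/(_ i j) : U *m A = diag_mx D *m U.
    by rewrite {1}AE !mulmxA mulmxV ?unitarymx_unit // mul1mx.
  rewrite mul_diag_mx !mxE mulrBl => <-.
  have -> : \sum_k U i k * A k j = c (a j) * U i j + c l * \sum_k U i k.
    rewrite mulr_sumr (bigD1 j) //= [X in _ = _ + X](bigD1 j) //= addrA.
    rewrite mxE eqxx.
    rewrite rmorphD; congr (_ + _); first by rewrite /=; ring.
    by apply: eq_bigr => k /negPf kj; rewrite mxE kj mulr0n add0r mulrC.
  by rewrite addrC addKr.
- by move=> i; rewrite -ler0c qE mul_conjC_ge0.
- apply: (fmorph_inj c); rewrite !rmorph_sum (eq_bigr _ (fun i _ => qE i)).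
  have := form_diag (const_mx 1); rewrite diag_const_mx mulmx1.
  rewrite mulVmx ?unitarymx_unit // mulmx1 mxE => H.
  transitivity (\sum_i u 0 i * u^T i 0).
    by apply: eq_bigr => i _; rewrite !mxE rmorphXn expr2.
  by rewrite H; apply: eq_bigr => i _; rewrite mxE mul1r.
- apply: (fmorph_inj c).
  have := form_diag D; rewrite -AE => H.
  transitivity ((u *m A *m u^T) 0 0); last first.
    rewrite H rmorph_sum; apply: eq_bigr => i _.
    by rewrite rmorphM /= dE qE.
  rewrite mxE rmorphD rmorphM rmorphXn /= !rmorph_sum /=.
  have uA i : (u *m A) 0 i = c (a i) * c (v i) + c l * \sum_k c (v k).
    rewrite mxE mulr_sumr (bigD1 i) //= [X in _ = _ + X](bigD1 i) //= addrA.
    rewrite !mxE eqxx.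
    rewrite rmorphD; congr (_ + _); first by rewrite /=; ring.
    by apply: eq_bigr => k /negPf ki; rewrite !mxE ki mulr0n add0r mulrC.
  rewrite expr2 mulrA [X in _ + X]big_distrr -big_split /=.
  by apply: eq_bigr => i _; rewrite uA !mxE rmorphM rmorphXn /=; ring.
Qed.

(** P = l P' is impossible by comparing sizes. *)
Lemma pencil_of_zeros_neq0 {F : fieldType} {n : nat} (a : 'I_n -> F) l :
  pencil_of_zeros a l != 0.
Proof.
have P0 : poly_of_zeros a != 0 by apply/monic_neq0/monic_prod_XsubC.
rewrite subr_eq0; apply/eqP => PE; have := lt_size_deriv P0.
by rewrite {2}PE ltnNge size_scale_leq.
Qed.

(** * Extreme zeros and span along the pencil *)

Section SpanOfZeros.
Variables (R : realType) (n : nat) (a : 'I_n -> R).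

(** Rayleigh bounds: in an eigenbasis the form is a sum of zeros with nonnegative weights of total
    [\sum_i v i ^+ 2]. *)
Lemma quad_form_bounds (l : R) (v : 'I_n -> R) :
  smallest_zero (pencil_of_zeros a l) * \sum_i v i ^+ 2 <= quad_form a l v
  <= largest_zero (pencil_of_zeros a l) * \sum_i v i ^+ 2.
Proof.
have [d [q [rd q0 -> ->]]] := spectral_quad_form a l v.
have F0 := pencil_of_zeros_neq0 a l.
rewrite !mulr_sumr; apply/andP; split; apply: ler_sum => i _;
  apply: ler_wpM2r => //.
  by have [] := smallest_zeroP F0 (rd i).
by have [] := largest_zeroP F0 (rd i).
Qed.

Lemma zeros_translate_bounds (l : R) i :
  smallest_zero (pencil_of_zeros a l) <= a i + l
  <= largest_zero (pencil_of_zeros a l).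
Proof.
have := quad_form_bounds l (fun j => (j == i)%:R); rewrite quad_form_delta.
rewrite (bigD1 i) //= big1 => [|j /negPf->]; last by rewrite expr0n.
by rewrite eqxx addr0 expr1n !mulr1.
Qed.

Hypothesis n_gt0 : (0 < n)%N.

Lemma extreme_zeros_root (l : R) :
  root (pencil_of_zeros a l) (smallest_zero (pencil_of_zeros a l)) /\
  root (pencil_of_zeros a l) (largest_zero (pencil_of_zeros a l)).
Proof.
(* The zero vector is a dummy; only some real zero is wanted, so that the extreme zeros are not the
   default value 0. *)
have [d [_ [/(_ (Ordinal n_gt0)) rd _ _ _]]] :=
  spectral_quad_form a l (fun=> 0).
have F0 := pencil_of_zeros_neq0 a l.
by split; [case: (smallest_zeroP F0 rd)|case: (largest_zeroP F0 rd)].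
Qed.

(** At an eigenvector for the largest zero at the intermediate parameter the Rayleigh bound is an
    equality. The form there is affine in the parameter, and the bounds at [l1] and [l2] finish. *)
Lemma largest_zero_convex (t l1 l2 : R) : 0 <= t <= 1 ->
  largest_zero (pencil_of_zeros a (t * l1 + (1 - t) * l2)) <=
  t * largest_zero (pencil_of_zeros a l1) +
  (1 - t) * largest_zero (pencil_of_zeros a l2).
Proof.
case/andP=> t0 t1; pose l := t * l1 + (1 - t) * l2; rewrite -/l.
have [v ev] := eigenvector_of_root _ _ _ (extreme_zeros_root l).2.
have [[i vi0] _] := ev; rewrite -(ler_pM2r (sum_sqr_gt0 v i vi0)).
rewrite -(quad_form_eigenvector _ _ _ _ ev) quad_form_conv.
rewrite [X in _ <= X]mulrDl -!mulrA.
have /andP[_ h1] := quad_form_bounds l1 v.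
have /andP[_ h2] := quad_form_bounds l2 v.
by apply: lerD; apply: ler_wpM2l; rewrite ?subr_ge0.
Qed.

Lemma smallest_zero_concave (t l1 l2 : R) : 0 <= t <= 1 ->
  t * smallest_zero (pencil_of_zeros a l1) +
  (1 - t) * smallest_zero (pencil_of_zeros a l2) <=
  smallest_zero (pencil_of_zeros a (t * l1 + (1 - t) * l2)).
Proof.
case/andP=> t0 t1; pose l := t * l1 + (1 - t) * l2; rewrite -/l.
have [v ev] := eigenvector_of_root _ _ _ (extreme_zeros_root l).1.
have [[i vi0] _] := ev; rewrite -(ler_pM2r (sum_sqr_gt0 v i vi0)).
rewrite -(quad_form_eigenvector _ _ _ _ ev) quad_form_conv.
rewrite [X in X <= _]mulrDl -!mulrA.
have /andP[h1 _] := quad_form_bounds l1 v.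
have /andP[h2 _] := quad_form_bounds l2 v.
by apply: lerD; apply: ler_wpM2l; rewrite ?subr_ge0.
Qed.

Lemma zero_span_convex (t l1 l2 : R) : 0 <= t <= 1 ->
  zero_span (pencil_of_zeros a (t * l1 + (1 - t) * l2)) <=
  t * zero_span (pencil_of_zeros a l1) +
  (1 - t) * zero_span (pencil_of_zeros a l2).
Proof.
move=> t01; have := largest_zero_convex t l1 l2 t01.
by have := smallest_zero_concave t l1 l2 t01; rewrite /zero_span; lra.
Qed.

(** At parameter 0 the extreme zeros are some [a i] and [a j]. Both are bounded after the same shift
    by [l], which cancels in the difference. *)
Lemma zero_span_min (l : R) :
  zero_span (pencil_of_zeros a 0) <= zero_span (pencil_of_zeros a l).
Proof.
have [/zero_of_pencil0[i Hi] /zero_of_pencil0[j Hj]] := extreme_zeros_root 0.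
rewrite /zero_span Hi Hj.
have /andP[h1 _] := zeros_translate_bounds l i.
have /andP[_ h2] := zeros_translate_bounds l j.
lra.
Qed.

Lemma zero_span_mono (l1 l2 : R) : 0 <= l1 * l2 -> `|l1| <= `|l2| ->
  zero_span (pencil_of_zeros a l1) <= zero_span (pencil_of_zeros a l2).
Proof.
move=> l12 h.
have [l20|l20] := eqVneq l2 0.
  by move: h; rewrite l20 normr0 normr_le0 => /eqP->.
(* The hypotheses put [l1] between 0 and [l2]: it is the combination of [l2] and 0 with weight [t]
   on [l2]. Convexity and the minimum at 0 then conclude. *)
pose t := l1 / l2.
have t0 : 0 <= t.
  have -> : t = l1 * l2 / l2 ^+ 2 by rewrite /t; field.
  by rewrite divr_ge0 ?sqr_ge0.
have t1 : t <= 1.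
  by rewrite -(ger0_norm t0) normf_div ler_pdivrMr ?normr_gt0 // mul1r.
have t01 : 0 <= t <= 1 by rewrite t0 t1.
have := zero_span_convex t l2 0 t01.
rewrite mulr0 addr0 divfK //; have := zero_span_min l2.
set D0 := zero_span _; set D2 := zero_span _ => D02 /le_trans; apply.
nra.
Qed.

End SpanOfZeros.

(** * From families of zeros back to polynomials *)

(** P splits over [R[i]], and each root has zero imaginary part, hence equals its real part. *)
Lemma real_rooted_polysP (R : realType) (n : nat) (P : {poly R}) :
  real_rooted_polys n P -> exists a : 'I_n -> R, P = poly_of_zeros a.
Proof.
case=> -[Pm Ps] Pr.
have [r PE] := closed_field_poly_normal (map_poly (real_complex R) P).
move: PE; rewrite lead_coef_map (monicP Pm) rmorph1 scale1r => PE.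
have rs : size r = n.
  apply/succn_inj; rewrite -Ps -(size_map_poly (real_complex R)) PE.
  by rewrite size_prod_XsubC.
exists (fun i => complex.Re (nth 0 r i)).
apply: (map_poly_inj (real_complex R)); rewrite PE rmorph_prod /=.
rewrite (big_nth 0) rs big_mkord; apply: eq_bigr => i _.
rewrite map_polyXsubC; congr ('X - _%:P).
have : root (map_poly (real_complex R) P) r`_i.
  by rewrite PE root_prod_XsubC mem_nth ?rs.
by move/Pr; case: (r`_i) => x y /= ->.
Qed.

Theorem corollary2 (R : realType) (n : nat) (n_ge2 : (2 <= n)%N) :
  [/\ (forall (L : set {poly R}) (P : {poly R}),
         LD_pencil n L -> L `<=` real_rooted_polys n -> canonical_basis n L P ->
         convex_function L (@zero_span R) /\
         (L P /\ forall Q : {poly R}, L Q -> zero_span P <= zero_span Q)),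
      (forall (P : {poly R}) (l : R),
         real_rooted_polys n P -> zero_span P <= zero_span (P - l *: P^`()))
    & (forall (P : {poly R}) (l1 l2 : R),
         real_rooted_polys n P -> 0 <= l1 * l2 -> `|l1| <= `|l2| ->
         zero_span (P - l1 *: P^`()) <= zero_span (P - l2 *: P^`()))].
Proof.
have n0 : (0 < n)%N by exact: ltn_trans n_ge2.
have min (P : {poly R}) (l : R) : real_rooted_polys n P ->
    zero_span P <= zero_span (P - l *: P^`()).
  case/real_rooted_polysP=> a ->.
  by rewrite -{1}(pencil_of_zeros0 a); exact: zero_span_min.
split=> // [L P _ LH [_ _ _ LE]|P l1 l2]; last first.
  by case/real_rooted_polysP=> a ->; exact: zero_span_mono.
have LP : L P by rewrite LE; exists 0; rewrite // scale0r subr0.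
have PH := LH _ LP; split; last first.
  by split=> // Q; rewrite LE => -[l _ <-]; exact: min.
move=> t x y; rewrite !inE LE => -[l1 _ <-] [l2 _ <-].
have [a PE] := real_rooted_polysP R n P PH.
have t01 : 0 <= (t%:num : R) <= 1 by rewrite ge0 le1.
have := zero_span_convex R n a n0 t%:num l1 l2 t01.
rewrite /pencil_of_zeros -PE; apply: le_trans.
(* The abstract convex combination unfolds to this one; being affine in the parameter, it is the
   member of the pencil at t l1 + (1 - t) l2. *)
rewrite -[X in X <= _]/(zero_span (t%:num *: (P - l1 *: P^`()) +
  (1 - t%:num) *: (P - l2 *: P^`()))).
rewrite le_eqVlt; apply/orP; left; apply/eqP; congr zero_span.
by rewrite -!mul_polyC !(rmorphB, rmorphD, rmorphM) /=; ring.
Qed.
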